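(* The monoid $\mathrm{End}(\mathbb{Q},circ)$ has automatic homeomorphicity: for every countable set $\Omega$ and every monoid isomorphism $\theta$ from $\mathrm{End}(\mathbb{Q},circ)$ onto a closed submonoid of $Tr(\Omega)$, $\theta$ is a homeomorphism.
   Context: The reflexive circular order on $\mathbb{Q}$ is the ternary relation $circ(x,y,z)$ iff $x\le y\le z$ or $y\le z\le x$ or $z\le x\le y$. $\mathrm{End}(\mathbb{Q},circ)$ is the monoid of all maps $f:\mathbb{Q}\to\mathbb{Q}$ (not necessarily injective) such that $circ(x,y,z)$ implies $circ(f(x),f(y),f(z))$. For a countable set $X$, $Tr(X)$ is the monoid of all maps $X\to X$. Transformation monoids carry the topology of pointwise convergence, whose basic open sets are $\{f : f(b_k)=c_k \text{ for } k=1,\dots,n\}$ for finite tuples of points. *)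

(* Defs.v *)
From HB Require Import structures.
From mathcomp Require Import all_boot all_order all_algebra.
From mathcomp Require Import all_classical all_reals all_analysis.

Set Implicit Arguments.
Unset Strict Implicit.
Unset Printing Implicit Defensive.

Import Order.TTheory GRing.Theory Num.Theory.

Local Open Scope classical_set_scope.

(* Countable sets are [countType]s; finite ones are included. *)
Definition Tr (X : countType) : Type := {ptws X -> discrete_topology X}.

Section FullTransformationMonoid.
Variable X : countType.

HB.instance Definition _ := Topological.on (Tr X).

Definition Tr_one : Tr X := fun x => x.
Definition Tr_mul (f g : Tr X) : Tr X := fun x => f (g x).

Fact Tr_mulA : associative Tr_mul. Proof. by []. Qed.
Fact Tr_mul1 : left_id Tr_one Tr_mul. Proof. by []. Qed.
Fact Tr_mulr1 : right_id Tr_one Tr_mul. Proof. by []. Qed.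

HB.instance Definition _ := isMonoid.Build (Tr X) Tr_mulA Tr_mul1 Tr_mulr1.

(* The topology inherited from [ptws] has as basic open sets the sets of maps
   with prescribed values at finitely many points. *)
Lemma Tr_nbhsP (f : Tr X) (A : set (Tr X)) :
  nbhs f A <->
  exists s : seq X, [set g : Tr X | {in s, forall x, g x = f x}] `<=` A.
Proof.
pose B (s : seq X) := [set g : Tr X | {in s, forall x, g x = f x}].
pose F : set_system (Tr X) := [set A | exists s, B s `<=` A].
have FF : Filter F.
  split=> [|P Q [s sP] [t tQ]|P Q PQ [s sP]].
  - by exists [::].
  - exists (s ++ t) => g gst; split; [apply: sP | apply: tQ] => x xs;
      by apply: gst; rewrite mem_cat xs ?orbT.
  - by exists s => g /sP /PQ.
have Ff : F --> f.
  apply/cvg_sup => x U [V [[W oW <-] Wfx WU]].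
  exists [:: x] => g gx; apply: WU; rewrite /= gx ?inE //.
split=> [/Ff //|[s sA]].
apply: filterS sA _.
elim: s => [|x s IHs].
  by apply: filterS filterT => g _ y; rewrite in_nil.
have Wx : nbhs f [set g : Tr X | g x = f x].
  exact: (@proj_continuous X (fun=> discrete_topology X) x f
    [set f x] (@discrete_set1 (discrete_topology X) (f x))).
apply: filterS (filterI Wx IHs) => g [gx gs] y.
by rewrite inE => /predU1P[->|/gs].
Qed.

End FullTransformationMonoid.

Section TransformationMonoid.
Variables (X : countType) (S : umagmaClosed (Tr X)).

(* The submonoid S of Tr X as a topological monoid in its own right, with the
   induced multiplication and the induced topology. *)
Record trmonoid := Trmonoid { trval :> Tr X; _ : trval \in S }.

HB.instance Definition _ := [isSub for trval].
HB.instance Definition _ := [Choice of trmonoid by <:].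

Fact trmonoid_closed : monoid_closed S.
Proof. by split; [exact: gpred1 | exact: gpredM]. Qed.

HB.instance Definition _ :=
  SubChoice_isSubMonoid.Build (Tr X) (fun f => f \in S) trmonoid trmonoid_closed.
HB.instance Definition _ := Topological.copy trmonoid
  (initial_topology trval).

End TransformationMonoid.

Definition homeomorphism (S T : topologicalType) (f : S -> T) : Prop :=
  continuous f /\ exists g : T -> S, [/\ cancel f g, cancel g f & continuous g].

Definition automatic_homeomorphicity (X : countType) (M : umagmaClosed (Tr X)) :
    Prop :=
  forall (Omega : countType) (N : umagmaClosed (Tr Omega))
    (theta : trmonoid M -> trmonoid N),
  closed [set f : Tr Omega | f \in N] ->
  monoid.monoid_morphism theta -> bijective theta ->
  homeomorphism theta.

Definition circ (x y z : rat) : bool :=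
  [|| (x <= y <= z)%R, (y <= z <= x)%R | (z <= x <= y)%R].

Definition End_circ : {pred Tr rat} :=
  [pred f : Tr rat |
    `[< forall x y z, circ x y z -> circ (f x) (f y) (f z) >]].

Fact End_circM : mulg_closed End_circ.
Proof.
by move=> f g /asboolP fP /asboolP gP; apply/asboolP => x y z /gP /fP.
Qed.

Fact End_circ1 : (1%g : Tr rat) \in End_circ.
Proof. exact/asboolP. Qed.

HB.instance Definition _ := isMulClosed.Build (Tr rat) End_circ End_circM.
HB.instance Definition _ := isMul1Closed.Build (Tr rat) End_circ End_circ1.

(* Main.v *)
(* Write M = End(Q, circ) and let M act on Omega through theta. The constant maps
   in M embed the action on Q in the action on Omega, which makes the inverse of
   theta continuous. As the image of theta is closed, theta then has a closed
   graph, and the proof of Banach's open mapping theorem (Baire category in the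
   group of units of M, followed by successive approximation) shows that theta
   is continuous on the group of units, and even uniformly so on its closure E,
   which by homogeneity of (Q, circ) consists of the embeddings: for every w in
   Omega there is a finite s such that e, e' in E which agree on s have
   theta e w = theta e' w.

   This passes to f = r o e and f' = r o e' for any r in M, so it remains to
   factor any f, f' which agree on s in this way, with e = e' wherever f = f'.
   Let psi be an isomorphism from Q x Q, ordered lexicographically, to Q.
   - If f and f' take at most the two values a and b, let e x = psi (x, c) where
     c codes f x, and let r map psi (x, c) to the value coded by c; r is in M as
     any map with at most two values is.
   - If f and f' are not constant and have convex fibers, let
     e x = psi (f x, k x), where k embeds the fiber of x, an arc of the circle,
     in Q, and let r be the first component of the inverse of psi.
   Maps with at least three values have convex fibers. If f has two values and
   f' more, one goes through a map with two values and convex fibers, a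
   composite of a two-valued map with f'. *)

Require Import Defs.
From mathcomp Require Import all_boot all_order all_algebra.
From mathcomp Require Import lra.
From mathcomp Require Import all_classical all_reals all_analysis.

Set Implicit Arguments.
Unset Strict Implicit.
Unset Printing Implicit Defensive.

Import Order.TTheory GRing.Theory Num.Theory.

Local Open Scope classical_set_scope.

(** * Continuity on the closure of the group of units *)

Definition initial_segment (X : countType) (n : nat) : seq X :=
  pmap unpickle (iota 0 n).

Lemma mem_initial_segment (X : countType) (x : X) (n : nat) :
  pickle x < n -> x \in initial_segment X n.
Proof.
move=> xn; rewrite mem_pmap; apply/mapP; exists (pickle x).
  by rewrite mem_iota.
by rewrite pickleK.
Qed.

Lemma sub_initial_segment (X : countType) (m n : nat) :
  m <= n -> {subset initial_segment X m <= initial_segment X n}.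
Proof.
move=> mn x; rewrite !mem_pmap => /mapP[i]; rewrite mem_iota => /= im ->.
by apply: map_f; rewrite mem_iota /= (leq_trans im).
Qed.

Lemma initial_segment_exhausts (X : countType) (s : seq X) :
  exists n, {subset s <= initial_segment X n}.
Proof.
exists (\max_(x <- s) pickle x).+1 => x xs; apply: mem_initial_segment.
by rewrite ltnS (big_rem x) //= leq_maxl.
Qed.

(** The value at [x] is read off at any stage whose list contains [x], as later stages keep it.
    Limits of successive approximations are formed this way. *)
Lemma eventually_constant_limit (X : eqType) (Y : Type) (f : nat -> X -> Y)
    (s : nat -> seq X) :
  (forall n, {subset s n <= s n.+1}) -> (forall x, exists n, x \in s n) ->
  (forall n, {in s n, f n.+1 =1 f n}) ->
  exists g, forall n, {in s n, g =1 f n}.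
Proof.
move=> s_incr s_exh f_cst.
have stable n k x : x \in s n -> x \in s (n + k) /\ f (n + k) x = f n x.
  move=> xn; elim: k => [|k [xk fk]]; first by rewrite addn0.
  by rewrite addnS f_cst //; split=> //; exact: s_incr.
have [N sN] := choice s_exh.
exists (fun x => f (N x) x) => n x xn.
have [Nn|/ltnW nN] := leqP (N x) n.
  by rewrite -(subnKC Nn) (stable _ _ _ (sN x)).2.
by rewrite -[in LHS](subnKC nN) (stable _ _ _ xn).2.
Qed.

Lemma closed_agree (X : countType) (A : set (Tr X)) (f : Tr X) :
  closed A ->
  (forall s : seq X, exists2 g : Tr X, A g & {in s, f =1 g}) -> A f.
Proof.
move=> clA fA; apply: clA => U /Tr_nbhsP[s sU].
have [g Ag fg] := fA s; exists g; split=> //.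
by apply: sU => x xs; rewrite fg.
Qed.

(** * The group of units and Baire category *)

Section Units.
Variables (X : countType) (M : umagmaClosed (Tr X)).
Implicit Types (u v w e : trmonoid M) (s : seq X).

Definition inverses u v := (u * v = 1)%g /\ (v * u = 1)%g.

(** Closeness is tested on the values of the unit, not on those of its inverse, so limits that fail
    to be surjective can occur. *)
Definition in_units_closure e :=
  forall s, exists u v, inverses u v /\ {in s, trval e =1 trval u}.

Lemma trmonoidP u v : trval u =1 trval v -> u = v.
Proof. by move=> uv; apply/val_inj/funext. Qed.

Lemma inverses1 : inverses 1%g 1%g.
Proof. by split; rewrite mulg1. Qed.

Lemma inverses_sym u v : inverses u v -> inverses v u.
Proof. by case. Qed.

Lemma inversesM u u' v v' :
  inverses u u' -> inverses v v' -> inverses (u * v)%g (v' * u')%g.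
Proof.
move=> [uu' u'u] [vv' v'v]; split.
  by rewrite mulgA -(mulgA u) vv' mulg1.
by rewrite mulgA -(mulgA v') u'u mulg1.
Qed.

Lemma inversesK u v : inverses u v -> cancel (trval u) (trval v).
Proof. by move=> [_ vu] x; have /(congr1 (fun f => trval f x)) := vu. Qed.

(* Baire category in the group of units, which is Polish because M is closed. *)
Lemma units_baire (C : nat -> set (trmonoid M)) :
  closed [set f : Tr X | f \in M] ->
  (forall u v, inverses u v -> exists n, C n u) ->
  exists n u v s, inverses u v /\ forall u' v' s',
    inverses u' v' -> {in s, trval u' =1 trval u} ->
    exists w w', [/\ inverses w w', C n w & {in s', trval w =1 trval u'}].
Proof.
move=> clM coverC; apply: contrapT => nowhere.
(* The basic neighborhood of [u] given by [s] contains no unit in [C n]. *)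
pose avoids n u s := forall w w', inverses w w' -> C n w ->
  ~ {in s, trval w =1 trval u}.
have avoid n u v s : inverses u v -> exists u' v' s',
    [/\ inverses u' v', {in s, trval u' =1 trval u} & avoids n u' s'].
  move=> uv; apply: contrapT => nav; apply: nowhere.
  exists n, u, v, s; split=> // u' v' s' uv' uu'.
  apply: contrapT => nw; apply: nav; exists u', v', s'; split=> // w w' ww' Cw wu.
  by apply: nw; exists w, w'.
pose state := (nat * {p : trmonoid M * trmonoid M | inverses p.1 p.2} * seq X)%type.
pose fwd (p : state) := trval (sval p.1.2).1.
pose bwd (p : state) := trval (sval p.1.2).2.
pose seg := initial_segment X.
(* Freezing the map also at the preimages of the first points makes the inverses converge, so that
   the limit is again a unit. *)
pose next (p : state) := p.2 ++ seg p.1.1 ++ map (bwd p) (seg p.1.1).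
pose step (p q : state) := [/\ q.1.1 = p.1.1.+1, {in next p, fwd q =1 fwd p},
  {subset next p <= q.2} & avoids p.1.1 (sval q.1.2).1 q.2].
have stepP p : {q | step p q}.
  apply: cid; case: p => [[n [[u v] /= uv]] s].
  pose p : state := (n, exist _ (u, v) uv, s).
  have [u' [v' [s' [uv' uu' av]]]] := avoid n u v (next p) uv.
  exists ((n.+1, exist _ (u', v') uv'), next p ++ s'); split=> //= [x xs|w w' ww' Cw wu'].
    by rewrite mem_cat xs.
  by apply: av ww' Cw _ => x xs; apply: wu'; rewrite mem_cat xs orbT.
have [p [p0 pS]] := dependent_choice stepP
  ((0, exist _ (1%g, 1%g) inverses1), [::] : seq X).
have pn n : (p n).1.1 = n.
  by elim: n => [|n IH]; rewrite ?p0 //; case: (pS n) => ->; rewrite IH.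
have segS n x : x \in seg n -> x \in seg n.+1.
  by apply: sub_initial_segment; exact: leqnSn.
have seg_exh x : exists n, x \in seg n.
  by exists (pickle x).+1; exact: mem_initial_segment.
have fwdK n : cancel (fwd (p n)) (bwd (p n)).
  by rewrite /fwd /bwd; case: (sval (p n).1.2) (svalP (p n).1.2) => u v; exact: inversesK.
have bwdK n : cancel (bwd (p n)) (fwd (p n)).
  rewrite /fwd /bwd; case: (sval (p n).1.2) (svalP (p n).1.2) => u v /inverses_sym.
  exact: inversesK.
have fwdE n : {in (p n).2, fwd (p n.+1) =1 fwd (p n)}.
  by case: (pS n) => _ E _ _ x xn; rewrite E // mem_cat xn.
have sub_next n : {subset next (p n) <= (p n.+1).2} by case: (pS n).
have sub_seg n : {subset seg n <= (p n.+1).2}.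
  by move=> x xn; apply: sub_next; rewrite !mem_cat pn xn orbT.
have [g gE] : exists g, forall n, {in (p n).2, g =1 fwd (p n)}.
  apply: (@eventually_constant_limit X X) => // [n x xn|x].
    by apply: sub_next; rewrite mem_cat xn.
  by have [n xn] := seg_exh x; exists n.+1; exact: sub_seg.
have bwd_mem n x : x \in seg n -> bwd (p n.+1) x \in (p n.+1).2.
  move=> xn; have bx : bwd (p n) x \in next (p n).
    by rewrite !mem_cat pn map_f ?orbT.
  suff -> : bwd (p n.+1) x = bwd (p n) x by exact: sub_next.
  by apply: (can_inj (fwdK n.+1)); rewrite bwdK; case: (pS n) => _ -> // _ _; rewrite bwdK.
have bwdE n : {in seg n, bwd (p n.+2) =1 bwd (p n.+1)}.
  move=> x xn; apply: (can_inj (fwdK n.+2)).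
  by rewrite bwdK fwdE ?bwdK // bwd_mem.
have [h hE] : exists h, forall n, {in seg n, h =1 bwd (p n.+1)}.
  exact: (@eventually_constant_limit X X (fun n => bwd (p n.+1))).
have gM : (g : Tr X) \in M.
  apply: (closed_agree clM) => s; have [n sn] := initial_segment_exhausts s.
  exists (fwd (p n.+1)); first exact: valP (sval (p n.+1).1.2).1.
  by move=> x /sn/sub_seg; exact: gE.
have hM : (h : Tr X) \in M.
  apply: (closed_agree clM) => s; have [n sn] := initial_segment_exhausts s.
  exists (bwd (p n.+1)); first exact: valP (sval (p n.+1).1.2).2.
  by move=> x /sn; exact: hE.
have gh : inverses (Trmonoid gM) (Trmonoid hM).
  split; apply: trmonoidP => x.
    have [n xn] := seg_exh x; rewrite -[LHS]/(g (h x)).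
    by rewrite (hE n) // (gE n.+1) ?bwdK // bwd_mem.
  have [n xn] := seg_exh x; have [m gxm] := seg_exh (g x); pose k := maxn n m.
  have xk : x \in seg k by apply: sub_initial_segment xn; exact: leq_maxl.
  have gxk : g x \in seg k by apply: sub_initial_segment gxm; exact: leq_maxr.
  by rewrite -[LHS]/(h (g x)) (hE k) // (gE k.+1) ?fwdK // sub_seg.
(* The limit lies in some [C n], but stage [n] has confined it to a neighborhood that misses
   [C n]. *)
have [n Cn] := coverC _ _ gh.
case: (pS n) => _ _ _; rewrite pn => /(_ _ _ gh Cn); apply=> x; exact: gE.
Qed.
End Units.

(** * Banach's open mapping argument for the group of units *)

Section ContinuityOnUnits.
Variables (X Omega : countType).
Variables (M : umagmaClosed (Tr X)) (N : umagmaClosed (Tr Omega)).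
Variable theta : trmonoid M -> trmonoid N.
Hypotheses (clM : closed [set f : Tr X | f \in M])
  (clN : closed [set f : Tr Omega | f \in N]).
Hypotheses (theta_hom : monoid.monoid_morphism theta)
  (theta_bij : bijective theta).
Hypothesis inv_cont : forall x : X, exists t : seq Omega, forall f g,
  {in t, trval (theta f) =1 trval (theta g)} -> trval f x = trval g x.
Implicit Types (t : seq Omega) (s : seq X).

Let theta1 : theta 1%g = 1%g. Proof. exact: theta_hom.1. Qed.
Let thetaM f g : theta (f * g)%g = (theta f * theta g)%g.
Proof. exact: theta_hom.2. Qed.

(** The maps [theta (w n)] converge to some [phi], which is in [N] as [N] is closed. By [inv_cont]
    its preimage under [theta] has the values of [w n] for large [n], hence those of [e]. *)
Lemma closed_graph (w : nat -> trmonoid M) (e : trmonoid M)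
    (T : nat -> seq Omega) (S : nat -> seq X) :
  (forall n, {subset T n <= T n.+1}) -> (forall t, exists n, {subset t <= T n}) ->
  (forall n, {subset S n <= S n.+1}) -> (forall x, exists n, x \in S n) ->
  (forall n, {in S n, trval e =1 trval (w n)}) ->
  (forall n, {in T n, trval (theta (w n.+1)) =1 trval (theta (w n))}) ->
  forall n, {in T n, trval (theta e) =1 trval (theta (w n))}.
Proof.
move=> T_incr T_exh S_incr S_exh ew wT.
have [phi phiE] : exists phi, forall n, {in T n, phi =1 trval (theta (w n))}.
  apply: (@eventually_constant_limit Omega Omega) => // x.
  by have [n xn] := T_exh [:: x]; exists n; apply: xn; rewrite mem_seq1.
have phiN : (phi : Tr Omega) \in N.
  apply: (closed_agree clN) => t; have [n tn] := T_exh t.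
  exists (trval (theta (w n))); first exact: valP.
  by move=> x /tn; exact: phiE.
have [theta' _ theta'K] := theta_bij.
have mono (Y : eqType) (Z : nat -> seq Y) m n :
    (forall n, {subset Z n <= Z n.+1}) -> m <= n -> {subset Z m <= Z n}.
  move=> Z_incr /subnKC <-; elim: (n - m) => [|k IH] y; first by rewrite addn0.
  by rewrite addnS => /IH; exact: Z_incr.
suff -> : e = theta' (Trmonoid phiN) by move=> n; rewrite theta'K; exact: phiE.
apply: trmonoidP => x; have [t tx] := inv_cont x.
have [m tm] := T_exh t; have [n xn] := S_exh x; pose k := maxn m n.
have xk : x \in S k by apply: mono xn => //; exact: leq_maxr.
rewrite (ew k) //; apply: tx => y /tm ym; rewrite theta'K /= (phiE k) //.
by apply: mono ym => //; exact: leq_maxl.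
Qed.

Let exhaustion t n := t ++ initial_segment Omega n.

Let exhaustionP t : (forall n, {subset exhaustion t n <= exhaustion t n.+1}) /\
  (forall t', exists n, {subset t' <= exhaustion t n}).
Proof.
split=> [n y|t']; last first.
  have [n tn] := initial_segment_exhausts t'; exists n => y /tn yn.
  by rewrite mem_cat yn orbT.
rewrite !mem_cat => /orP[->//|yn]; apply/orP; right.
exact: sub_initial_segment yn.
Qed.

Let fixes_pt (f : trmonoid M) s := {in s, forall x, trval f x = x}.

(** Sorting units by the action of their images on [t] gives countably many classes, one of which is
    dense near some unit. The quotient of two members of a class has an image that fixes [t]. *)
Lemma approx_units_fixing t : exists s, forall u u', inverses u u' ->
  fixes_pt u s -> forall s', exists v v', [/\ inverses v v',
    {in t, forall y, trval (theta v) y = y} & {in s', trval v =1 trval u}].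
Proof.
pose C n := [set u : trmonoid M | pickle (map (trval (theta u)) t) = n].
have [u _ _|n [u [u' [s [uu' dense]]]]] := @units_baire X M C clM.
  by exists (pickle (map (trval (theta u)) t)).
exists s => v v' vv' vs s'.
(* As [w0] equals [u] on the image of [s'] under [v], and [w] will equal [u * v] on [s'], the
   quotient [w0' * w] equals [v] on [s']. *)
have [w0 [w0' [ww0 Cw0 w0E]]] := dense u u' (map (trval v) s') uu' (fun _ _ => erefl).
have [|w [w' [ww Cw wE]]] := dense (u * v)%g (v' * u')%g s' (inversesM uu' vv').
  by move=> x xs; rewrite -[LHS]/(trval u (trval v x)) vs.
exists (w0' * w)%g, (w' * w0)%g; split.
- exact: inversesM (inverses_sym ww0) ww.
- have /eq_in_map wt : map (trval (theta w)) t = map (trval (theta w0)) t.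
    by apply: (pcan_inj pickleK); rewrite Cw Cw0.
  move=> y yt; rewrite thetaM -[LHS]/(trval (theta w0') (trval (theta w) y)) wt //.
  rewrite -[LHS]/(trval (theta w0' * theta w0)%g y) -thetaM.
  by case: ww0 => _ ->; rewrite theta1.
- move=> x xs; rewrite -[LHS]/(trval w0' (trval w x)) wE //.
  rewrite -[trval (u * v)%g x]/(trval u (trval v x)) -w0E ?map_f //.
  exact: inversesK ww0 _.
Qed.

(** The unit is a limit of finite products of units whose images fix larger and larger parts of
    [Omega], all containing [t]; [closed_graph] handles the limit. *)
Lemma units_stabilizer_open t : exists s, forall u u', inverses u u' ->
  fixes_pt u s -> {in t, forall y, trval (theta u) y = y}.
Proof.
have [sigma sigmaP] := choice approx_units_fixing.
pose T := exhaustion t.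
have [T_incr T_exh] := exhaustionP t.
(* The first list makes the error at stage [n] admissible for the next correction, the second one
   forces convergence. *)
pose S n := sigma (T n) ++ initial_segment X n.
exists (S 0) => g g' gg' gS.
pose state := {p : nat * (trmonoid M * trmonoid M) |
  inverses p.2.1 p.2.2 /\ {in S p.1, trval g =1 trval p.2.1}}.
pose step (p q : state) := (sval q).1 = (sval p).1.+1 /\
  {in T (sval p).1, trval (theta (sval q).2.1) =1 trval (theta (sval p).2.1)}.
have stepP p : {q | step p q}.
  apply: cid; case: p => [[n [w w']] /= [ww' gw]].
  (* The error [w' * g] fixes [sigma (T n)]; multiplying [w] by an approximation [v] of it extends
     the agreement with [g] to [S n.+1]. *)
  have [|v [v' [vv' vT vS]]] :=
      sigmaP (T n) _ _ (inversesM (inverses_sym ww') gg') _ (S n.+1).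
    move=> x xn; rewrite -[LHS]/(trval w' (trval g x)) gw; first exact: inversesK ww' _.
    by rewrite mem_cat xn.
  have wvP : inverses (w * v)%g (v' * w')%g /\ {in S n.+1, trval g =1 trval (w * v)%g}.
    split=> [|x xn]; first exact: inversesM.
    rewrite -[RHS]/(trval w (trval v x)) vS //.
    by rewrite -[RHS]/(trval w (trval w' (trval g x))) (inversesK (inverses_sym ww')).
  exists (exist _ (n.+1, ((w * v)%g, (v' * w')%g)) wvP); split=> //= y yn.
  by rewrite thetaM -[LHS]/(trval (theta w) (trval (theta v) y)) vT.
have p0P : inverses (1%g : trmonoid M) 1%g /\ {in S 0, trval g =1 trval (1%g : trmonoid M)}.
  by split; [exact: inverses1 | move=> x xS; rewrite gS].
have [p [p0 pS]] := dependent_choice stepP (exist _ (0, (1%g, 1%g)) p0P).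
have pn n : (sval (p n)).1 = n by elim: n => [|n IH]; rewrite ?p0 // (pS n).1 IH.
move=> y yt.
rewrite (@closed_graph (fun n => (sval (p n)).2.1) g T (initial_segment X) _ _ _ _ _ _ 0) //.
- by rewrite p0 /= theta1.
- by move=> n; apply: sub_initial_segment.
- by move=> x; exists (pickle x).+1; exact: mem_initial_segment.
- move=> n x xn; case: (svalP (p n)) => _ -> //; rewrite pn.
  by rewrite mem_cat xn orbT.
- by move=> n; have := (pS n).2; rewrite pn.
- by rewrite mem_cat yt.
Qed.

(** Units that agree on [sigma t'] have a quotient fixing [sigma t'], so translation gives
    uniformity on units. Elements of the closure are approximated by units and reached by
    [closed_graph]. *)
Theorem units_closure_continuous t : exists s, forall e e',
  in_units_closure e -> in_units_closure e' -> {in s, trval e =1 trval e'} ->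
  {in t, trval (theta e) =1 trval (theta e')}.
Proof.
have [sigma sigmaP] := choice units_stabilizer_open.
have sigma_unif t' u u' v v' : inverses u u' -> inverses v v' ->
    {in sigma t', trval u =1 trval v} -> {in t', trval (theta u) =1 trval (theta v)}.
  move=> uu' vv' uv y yt.
  have /(_ y yt) E : {in t', forall y, trval (theta (v' * u)%g) y = y}.
    apply: sigmaP (inversesM (inverses_sym vv') uu') _ => x xs.
    by rewrite -[LHS]/(trval v' (trval u x)) uv //; exact: inversesK vv' _.
  rewrite -[in RHS]E -[RHS]/(trval (theta v * theta (v' * u))%g y) -thetaM mulgA.
  by rewrite vv'.1 mul1g.
pose T := exhaustion t.
have [T_incr T_exh] := exhaustionP t.
pose S n := flatten [seq sigma (T i) | i <- iota 0 n.+1] ++ initial_segment X n.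
have S_incr n : {subset S n <= S n.+1}.
  move=> x; rewrite mem_cat => /orP[xn|xn]; rewrite mem_cat; last first.
    by rewrite (sub_initial_segment (leqnSn n)) ?orbT.
  by rewrite -[n.+2]addn1 iotaD map_cat flatten_cat mem_cat xn.
have sigmaS n : {subset sigma (T n) <= S n}.
  move=> x xn; rewrite mem_cat; apply/orP; left; apply/flattenP.
  by exists (sigma (T n)) => //; apply: map_f; rewrite mem_iota /= add0n ltnS.
have approx e : in_units_closure e -> exists2 u, (exists u', inverses u u') &
    {in sigma (T 0), trval e =1 trval u} /\ {in t, trval (theta e) =1 trval (theta u)}.
  move=> /[dup] ecl /(_ (S _)) eS.
  have [w wP] := choice eS; have [w' {}wP] := choice wP.
  exists (w 0); first by exists (w' 0); case: (wP 0).
  split=> [x xs|y yt]; first by case: (wP 0) => _ -> //; exact: sigmaS.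
  rewrite (@closed_graph w e T S _ _ _ _ _ _ 0) //.
  - by move=> x; exists (pickle x).+1; rewrite mem_cat mem_initial_segment ?orbT.
  - by move=> n; case: (wP n).
  - move=> n; apply: sigma_unif (wP n.+1).1 (wP n).1 _ => x /sigmaS xn.
    by rewrite -(wP n.+1).2 ?(wP n).2 //; exact: S_incr.
  - by rewrite mem_cat yt.
exists (sigma (T 0)) => e e' /approx[u [u' uu'] [eu teu]].
move=> /approx[v [v' vv'] [ev tev]] ee' y yt.
rewrite teu // tev //; apply: (sigma_unif (T 0)) uu' vv' _ _ _.
  by move=> x xs; rewrite -eu // ee' // ev.
by rewrite mem_cat yt.
Qed.

End ContinuityOnUnits.

(** * Back-and-forth *)

(** [P] is the invariant of the finite partial maps. The last conclusion lets a relation between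
    finitely many values of [h] be verified inside a single list satisfying [P]. *)
Lemma back_and_forth (A B : countType) (P : seq (A * B) -> Prop) (l0 : seq (A * B)) :
  P l0 ->
  (forall l x, P l -> exists y, P ((x, y) :: l)) ->
  (forall l y, P l -> exists x, P ((x, y) :: l)) ->
  (forall l, P l -> {in l &, forall p q, (p.1 == q.1) = (p.2 == q.2)}) ->
  exists h k, [/\ cancel h k, cancel k h, {in l0, forall p, h p.1 = p.2} &
    forall s : seq A, exists2 l, P l & {in s, forall x, (x, h x) \in l}].
Proof.
move=> Pl0 forth back P_inj.
pose state := (nat * {l | P l})%type.
pose step (p q : state) := [/\ q.1 = p.1.+1, {subset sval p.2 <= sval q.2},
  (forall x : A, pickle x = p.1 -> exists y, (x, y) \in sval q.2) &
  (forall y : B, pickle y = p.1 -> exists x, (x, y) \in sval q.2)].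
have stepP p : {q | step p q}.
  apply: cid; case: p => [n [l Pl]].
  have [l1 [Pl1 ll1 l1n]] : exists l1, [/\ P l1, {subset l <= l1} &
      forall x : A, pickle x = n -> exists y, (x, y) \in l1].
    have [[x xn]|nx] := pselect (exists x : A, pickle x = n).
      have [y Py] := forth l x Pl; exists ((x, y) :: l); split=> //.
        by move=> z zl; rewrite inE zl orbT.
      move=> x' x'n; exists y; rewrite inE (_ : x' = x) ?eqxx //.
      by apply: (pcan_inj pickleK); rewrite x'n.
    by exists l; split=> // x xn; case: nx; exists x.
  have [l2 [Pl2 ll2 l2n]] : exists l2, [/\ P l2, {subset l1 <= l2} &
      forall y : B, pickle y = n -> exists x, (x, y) \in l2].
    have [[y yn]|ny] := pselect (exists y : B, pickle y = n).
      have [x Px] := back l1 y Pl1; exists ((x, y) :: l1); split=> //.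
        by move=> z zl; rewrite inE zl orbT.
      move=> y' y'n; exists x; rewrite inE (_ : y' = y) ?eqxx //.
      by apply: (pcan_inj pickleK); rewrite y'n.
    by exists l1; split=> // y yn; case: ny; exists y.
  exists (n.+1, exist _ l2 Pl2); split=> //= [z /ll1/ll2 //|x /l1n[y /ll2]].
  by exists y.
have [p [p0 pS]] := dependent_choice stepP (0, exist _ l0 Pl0).
have pn n : (p n).1 = n.
  by elim: n => [|n IH]; rewrite ?p0 //; case: (pS n) => ->; rewrite IH.
pose l n := sval (p n).2.
have l_mono m n : m <= n -> {subset l m <= l n}.
  move=> /subnKC <-; elim: (n - m) => [|k IH] z; first by rewrite addn0.
  by rewrite addnS => /IH; case: (pS (m + k)) => _ S _ _; exact: S.
have total x : exists y, exists n, (x, y) \in l n.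
  have [_ _ /(_ x)] := pS (pickle x); rewrite pn => /(_ erefl)[y xy] _.
  by exists y, (pickle x).+1.
have onto y : exists x, exists n, (x, y) \in l n.
  have [_ _ _ /(_ y)] := pS (pickle y); rewrite pn => /(_ erefl)[x xy].
  by exists x, (pickle y).+1.
have inj m n q r : q \in l m -> r \in l n -> (q.1 == r.1) = (q.2 == r.2).
  move=> qm rn; apply: (P_inj _ (svalP (p (maxn m n)).2)).
    exact: l_mono (leq_maxl m n) _ qm.
  exact: l_mono (leq_maxr m n) _ rn.
have [h hP] := choice total; have [k kP] := choice onto.
exists h, k; split=> [x|y|q ql|s].
- have [m xm] := hP x; have [n yn] := kP (h x).
  by have /= := inj _ _ _ _ yn xm; rewrite eqxx => /eqP.
- have [m xm] := kP y; have [n yn] := hP (k y).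
  by have /= := inj _ _ _ _ yn xm; rewrite eqxx => /esym/eqP.
- have [m xm] := hP q.1; have := inj _ 0 _ q xm; rewrite /l p0 => /(_ ql) /=.
  by rewrite eqxx => /esym/eqP.
- have [n nP] := choice hP.
  exists (l (\max_(x <- s) n x)) => [|x xs]; first exact: svalP.
  by apply: l_mono (nP x); rewrite (big_rem x) //= leq_maxl.
Qed.

(** * Dense linear orders without endpoints *)

Definition dense_unbounded d (T : orderType d) :=
  [/\ forall x y : T, (x < y)%O -> exists z, (x < z < y)%O,
      forall x : T, exists y, (x < y)%O & forall x : T, exists y, (y < x)%O].

Lemma seq_extremum (T : eqType) (r : rel T) (x : T) (s : seq T) :
  reflexive r -> transitive r -> total r ->
  exists2 m, m \in x :: s & {in x :: s, forall y, r y m}.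
Proof.
move=> r_refl r_trans r_total; elim: s => [|y s [m ms mP]].
  by exists x; rewrite ?mem_head // => y; rewrite inE => /eqP ->.
have [ym|my] := orP (r_total y m).
  exists m => [|z]; first by move: ms; rewrite !inE => /orP[]->; rewrite ?orbT.
  rewrite !inE => /or3P[/eqP->|/eqP->//|zs]; apply: mP; first exact: mem_head.
  by rewrite inE zs orbT.
exists y => [|z]; first by rewrite !inE eqxx orbT.
have mz : z \in x :: s -> r z y by move=> /mP/r_trans; apply; exact: my.
rewrite !inE => /or3P[/eqP zx|/eqP->|zs]; [|exact: r_refl|]; apply: mz.
  by rewrite zx mem_head.
by rewrite inE zs orbT.
Qed.

(** The value [c] to be avoided serves for circular orders: after a cut, it will be the image of the
    cut point itself. *)
Lemma separation d (T : orderType d) (L H : seq T) (c : T) :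
  dense_unbounded T -> {in L & H, forall x y, x < y}%O ->
  exists2 z, z != c & {in L, forall x, x < z}%O /\ {in H, forall y, z < y}%O.
Proof.
move=> [dense above below].
have sep (L' : seq T) : {in L' & H, forall x y, x < y}%O ->
    exists z, {in L', forall x, x < z}%O /\ {in H, forall y, z < y}%O.
  have max x s := @seq_extremum T <=%O x s le_refl le_trans (@le_total _ T).
  have min x s := @seq_extremum T >=%O x s le_refl
    (fun _ _ _ u v => le_trans v u) (fun x y => le_total y x).
  case: L' H => [|x L'] [|y H'] LH.
  - by exists c.
  - have [m _ mP] := min y H'; have [z zm] := below m.
    by exists z; split=> // w /mP; exact: lt_le_trans.
  - have [m _ mP] := max x L'; have [z zm] := above m.
    by exists z; split=> // w /mP/le_lt_trans; apply.
  - have [m mL mP] := max x L'; have [n nH nP] := min y H'.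
    have [z /andP[mz zn]] := dense _ _ (LH _ _ mL nH).
    exists z; split=> [w /mP/le_lt_trans|w /nP]; first exact.
    exact: lt_le_trans.
move=> LH; have [z [Lz zH]] := sep L LH.
have [zc|] := eqVneq z c; last by exists z.
have [|w [Lw wH]] := sep (z :: L).
  by move=> x y; rewrite inE => /predU1P[->|xL] yH; [exact: zH|exact: LH].
exists w; first by rewrite -zc gt_eqF // Lw // mem_head.
by split=> // x xL; apply: Lw; rewrite inE xL orbT.
Qed.

Definition lt_iso d d' (A : orderType d) (B : orderType d') (l : seq (A * B)) :=
  {in l &, forall p q, (p.1 < q.1)%O = (p.2 < q.2)%O}.

Lemma lt_iso_extension d d' (A : orderType d) (B : orderType d')
    (l : seq (A * B)) (x : A) (c : B) :
  dense_unbounded B -> lt_iso l -> x \notin map fst l ->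
  exists2 y, y != c & {in l, forall p, ((p.1 < x) = (p.2 < y)) /\ ((x < p.1) = (y < p.2))}%O.
Proof.
move=> duB l_iso xl.
pose L := [seq p.2 | p <- l & (p.1 < x)%O]; pose H := [seq p.2 | p <- l & (x < p.1)%O].
have [|y yc [Ly yH]] := @separation _ B L H c duB.
  move=> _ _ /mapP[p + ->] /mapP[q + ->]; rewrite !mem_filter.
  by move=> /andP[px pl] /andP[xq ql]; rewrite -l_iso //; exact: lt_trans xq.
exists y => // p pl.
have [px|xp|px] := ltgtP p.1 x.
- have py : (p.2 < y)%O by apply: Ly; apply: map_f; rewrite mem_filter px.
  by rewrite py (lt_gtF py).
- have yp : (y < p.2)%O by apply: yH; apply: map_f; rewrite mem_filter xp.
  by rewrite yp (lt_gtF yp).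
- by move: xl; rewrite -px map_f.
Qed.

Lemma lt_iso_eq d d' (A : orderType d) (B : orderType d') (l : seq (A * B)) :
  lt_iso l -> {in l &, forall p q, (p.1 == q.1) = (p.2 == q.2)}.
Proof.
by move=> l_iso p q pl ql; rewrite !eq_le !leNgt !l_iso.
Qed.

Lemma lt_iso_forth d d' (A : orderType d) (B : orderType d') (c : B)
    (l : seq (A * B)) (x : A) :
  dense_unbounded B -> lt_iso l -> exists y, lt_iso ((x, y) :: l).
Proof.
move=> duB l_iso.
have [/mapP[p pl ->]|xl] := boolP (x \in map fst l).
  exists p.2; rewrite -surjective_pairing => q r; rewrite !inE.
  by move=> /predU1P[->|ql] /predU1P[->|rl]; exact: l_iso.
have [y _ yP] := lt_iso_extension c duB l_iso xl.
exists y => q r; rewrite !inE.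
move=> /predU1P[->|ql] /predU1P[->|rl] /=; rewrite ?ltxx //.
- by case: (yP r rl).
- by case: (yP q ql).
- exact: l_iso.
Qed.

Definition swap_pair (A B : Type) (p : A * B) : B * A := (p.2, p.1).

Lemma lt_iso_swap d d' (A : orderType d) (B : orderType d') (l : seq (A * B)) :
  lt_iso (map (@swap_pair A B) l) <-> lt_iso l.
Proof.
split=> [iso p q pl ql|iso _ _ /mapP[p pl ->] /mapP[q ql ->] /=].
  by have := iso _ _ (map_f _ pl) (map_f _ ql).
by rewrite iso.
Qed.

Lemma rat_dense_unbounded : dense_unbounded rat.
Proof.
split=> [x y xy|x|x].
- by exists ((x + y) / 2)%R; rewrite !midf_lt.
- by exists (x + 1)%R; lra.
- by exists (x - 1)%R; lra.
Qed.

Lemma lt_lexi (a b c d : rat) : (((a, b) : (rat *l rat)%type) < (c, d))%O =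
  (a < c)%R || (a == c) && (b < d)%R.
Proof. by rewrite Order.ProdLexiOrder.ltEprodlexi /=; case: (ltgtP a c). Qed.

Lemma ratl_dense_unbounded : dense_unbounded (rat *l rat)%type.
Proof.
split=> [[a b] [c d]|[a b]|[a b]].
- rewrite lt_lexi => /orP[ac|/andP[/eqP <- bd]].
    by exists (a, b + 1)%R; rewrite !lt_lexi ac eqxx ltxx; lra.
  by exists (a, (b + d) / 2)%R; rewrite !lt_lexi eqxx ltxx !midf_lt.
- by exists (a, b + 1)%R; rewrite lt_lexi eqxx ltxx; lra.
- by exists (a, b - 1)%R; rewrite lt_lexi eqxx ltxx; lra.
Qed.

(** Cantor's theorem: both orders are countable, dense and without endpoints. *)
Lemma rat_lexi_iso : exists psi : rat * rat -> rat,
  bijective psi /\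
  forall a b c d, (psi (a, b) < psi (c, d))%R = (a < c)%R || (a == c) && (b < d)%R.
Proof.
have [|l x liso|l y liso|l liso|phi [psi [phiK psiK _ phiP]]] :=
  @back_and_forth rat (rat *l rat)%type (@lt_iso _ _ _ _) [::].
- by [].
- exact: (@lt_iso_forth _ _ _ _ ((0, 0)%R : (rat *l rat)%type) _ _ ratl_dense_unbounded liso).
- have [x xP] := @lt_iso_forth _ _ _ _ 0%R _ y rat_dense_unbounded
    ((lt_iso_swap l).2 liso).
  by exists x; apply/lt_iso_swap.
- exact: lt_iso_eq.
exists psi; split=> [|a b c d]; first by exists phi.
have [l liso lP] := phiP [:: psi (a, b); psi (c, d)].
rewrite -lt_lexi; have := liso _ _ (lP _ (mem_head _ _)) (lP _ (mem_last _ _)).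
by rewrite /= !psiK.
Qed.

(** * The strict circular order *)

Definition scirc (x y z : rat) : bool :=
  [|| (x < y < z)%R, (y < z < x)%R | (z < x < y)%R].

Lemma circE x y z : circ x y z = ~~ scirc z y x.
Proof. by rewrite /circ /scirc; apply/idP/idP; lra. Qed.

Lemma scircE x y z : scirc x y z = ~~ circ z y x.
Proof. by rewrite circE negbK. Qed.

Lemma scirc_rot x y z : scirc x y z = scirc y z x.
Proof. by rewrite /scirc; apply/idP/idP; lra. Qed.

Lemma scirc_neq x y z : scirc x y z -> [/\ x != y, y != z & z != x].
Proof. by rewrite /scirc => xyz; split; lra. Qed.

Lemma scirc_irr1 x y : scirc x x y = false.
Proof. by rewrite /scirc; lra. Qed.

Lemma scirc_irr3 x y : scirc x y x = false.
Proof. by rewrite /scirc; lra. Qed.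

Lemma scirc_total x y z : x != y -> y != z -> z != x -> scirc x y z || scirc z y x.
Proof. by rewrite /scirc => /lt_total + /lt_total + /lt_total +; lra. Qed.

Lemma scirc_asym x y z : scirc x y z -> ~~ scirc z y x.
Proof. by rewrite /scirc; lra. Qed.

Lemma scirc_cut p x y z : x != p -> y != p -> z != p ->
  scirc x y z = [|| scirc p x y && scirc p y z, scirc p y z && scirc p z x
                  | scirc p z x && scirc p x y].
Proof.
rewrite /scirc => /lt_total + /lt_total + /lt_total +.
by move=> A B C; apply/idP/idP; move: A B C; lra.
Qed.

(* The cyclic order cut at p, as a linear order: the Moebius transformation
   sending p to infinity preserves the cyclic order of the projective line. *)
Definition cut_at (p x : rat) : rat := ((p - x)^-1)%R.

Lemma cut_lt p x y : x != p -> y != p -> (cut_at p x < cut_at p y)%R = scirc p x y.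
Proof.
rewrite /cut_at /scirc => xp yp.
have [xp'|xp'] : (x < p \/ p < x)%R by case/lt_total/orP: xp; auto.
all: have [yp'|yp'] : (y < p \/ p < y)%R by case/lt_total/orP: yp; auto.
- by rewrite ltf_pV2 ?posrE; [apply/idP/idP| |]; lra.
- have : ((p - y)^-1 < 0)%R by rewrite invr_lt0; lra.
  have : (0 < (p - x)^-1)%R by rewrite invr_gt0; lra.
  by move=> ? ?; apply/idP/idP; lra.
- have : ((p - x)^-1 < 0)%R by rewrite invr_lt0; lra.
  have : (0 < (p - y)^-1)%R by rewrite invr_gt0; lra.
  by move=> ? ?; apply/idP/idP; lra.
- by rewrite ltf_nV2 ?negrE; [apply/idP/idP| |]; lra.
Qed.

Lemma cut_inj p : injective (cut_at p).
Proof. by move=> x y /invr_inj/addrI/oppr_inj. Qed.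

Lemma cut_scirc p x y z : x != p -> y != p -> z != p ->
  scirc (cut_at p x) (cut_at p y) (cut_at p z) = scirc x y z.
Proof.
by move=> xp yp zp; rewrite (scirc_cut xp yp zp) {1}/scirc !cut_lt.
Qed.

(** The first clause always holds for lists of at most two pairs, so equality of points needs a
    clause of its own. *)
Definition scirc_iso (l : seq (rat * rat)) :=
  {in l & l & l, forall p q r, scirc p.1 q.1 r.1 = scirc p.2 q.2 r.2} /\
  {in l &, forall p q, (p.1 == q.1) = (p.2 == q.2)}.

Definition cut_pair (a p : rat * rat) := (cut_at a.1 p.1, cut_at a.2 p.2).

(** Cutting both circles at a matched pair [a] reduces the extension of circular partial
    isomorphisms to the linear case. *)
Lemma scirc_isoP l a : a \in l ->
  scirc_iso l <-> {in l, forall p, (p.1 == a.1) = (p.2 == a.2)} /\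
    lt_iso [seq cut_pair a p | p <- l & p.1 != a.1].
Proof.
move=> al; split=> [[iso eqs]|[eqs iso]].
  split=> [p pl|_ _ /mapP[p + ->] /mapP[q + ->]]; first exact: eqs.
  rewrite !mem_filter => /andP[pa pl] /andP[qa ql] /=.
  by rewrite !cut_lt -?eqs // iso.
have memc r : r \in l -> r.1 != a.1 ->
    cut_pair a r \in [seq cut_pair a p | p <- l & p.1 != a.1].
  by move=> rl ra; apply: map_f; rewrite mem_filter ra.
have iso1 : {in l &, forall p q, scirc a.1 p.1 q.1 = scirc a.2 p.2 q.2}.
  move=> p q pl ql; have [pa|pa] := eqVneq p.1 a.1.
    have /eqP -> : p.2 == a.2 by rewrite -eqs ?pa.
    by rewrite pa !scirc_irr1.
  have [qa|qa] := eqVneq q.1 a.1.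
    have /eqP -> : q.2 == a.2 by rewrite -eqs ?qa.
    by rewrite qa !scirc_irr3.
  by have := iso _ _ (memc p pl pa) (memc q ql qa); rewrite /= !cut_lt -?eqs.
split=> [p q r pl ql rl|p q pl ql].
  have [pa|pa] := eqVneq p.1 a.1.
    have /eqP -> : p.2 == a.2 by rewrite -eqs ?pa.
    by rewrite pa iso1.
  have [qa|qa] := eqVneq q.1 a.1.
    have /eqP -> : q.2 == a.2 by rewrite -eqs ?qa.
    by rewrite qa scirc_rot iso1 // -scirc_rot.
  have [ra|ra] := eqVneq r.1 a.1.
    have /eqP -> : r.2 == a.2 by rewrite -eqs ?ra.
    by rewrite ra -scirc_rot iso1 // scirc_rot.
  by rewrite (@scirc_cut a.1 p.1) // (@scirc_cut a.2 p.2) -?eqs // !iso1.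
have [pa|pa] := eqVneq p.1 a.1.
  have /eqP -> : p.2 == a.2 by rewrite -eqs ?pa.
  by rewrite pa ![a.1 == _]eq_sym ![a.2 == _]eq_sym eqs.
have [qa|qa] := eqVneq q.1 a.1.
  have /eqP -> : q.2 == a.2 by rewrite -eqs ?qa.
  by rewrite qa (negPf pa) -eqs // (negPf pa).
have := lt_iso_eq iso (memc p pl pa) (memc q ql qa).
by rewrite /= !(inj_eq (@cut_inj _)).
Qed.

Lemma scirc_iso_forth l x : scirc_iso l -> exists y, scirc_iso ((x, y) :: l).
Proof.
move=> iso; have [/mapP[p pl ->]|xl] := boolP (x \in map fst l).
  exists p.2; rewrite -surjective_pairing; have [isol eql] := iso.
  have sub q : q \in p :: l -> q \in l by rewrite inE => /predU1P[->|].
  split=> [q r s /sub ql /sub rl /sub sl|q r /sub ql /sub rl].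
    exact: isol.
  exact: eql.
case: l iso xl => [|a l] iso xl.
  exists 0%R; split=> [p q r|p q]; rewrite !mem_seq1.
    by move=> /eqP-> /eqP-> /eqP->; rewrite !scirc_irr1.
  by move=> /eqP-> /eqP->; rewrite !eqxx.
have al : a \in a :: l by exact: mem_head.
have [eqs lti] := (scirc_isoP al).1 iso.
have xa : x != a.1 by move: xl; rewrite inE negb_or => /andP[].
set l' := [seq _ | _ <- _ & _] in lti.
have xl' : cut_at a.1 x \notin map fst l'.
  apply/negP => /mapP[_ /mapP[p + ->] /= /cut_inj xp].
  by rewrite mem_filter => /andP[_ pl]; move: xl; rewrite xp map_f.
(* With the convention that 0 has inverse 0, [cut_at] sends the cut point to 0, so [y' != 0] keeps
   the new point apart from [a.2]. *)
have [y' y'0 y'P] := lt_iso_extension 0%R rat_dense_unbounded lti xl'.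
pose y := (a.2 - y'^-1)%R.
have y'E : y' = cut_at a.2 y by rewrite /cut_at /y opprB addrC subrK invrK.
have ya : y != a.2.
  by rewrite /y -subr_eq0 addrAC subrr add0r oppr_eq0 invr_eq0.
have al' : a \in (x, y) :: a :: l by rewrite inE al orbT.
exists y; apply/(scirc_isoP al'); split=> [p|].
  by rewrite inE => /predU1P[->|/eqs//] /=; rewrite (negPf xa) (negPf ya).
rewrite /= xa map_cons -/l' => p q; rewrite !inE => /predU1P[->|pl] /predU1P[->|ql].
- by rewrite /= !ltxx.
- by rewrite /= -y'E; case: (y'P _ ql).
- by rewrite /= -y'E; case: (y'P _ pl).
- exact: lti.
Qed.

Lemma scirc_iso_swap l : scirc_iso (map (@swap_pair rat rat) l) <-> scirc_iso l.
Proof.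
split=> [[iso eqs]|[iso eqs]]; split.
- by move=> p q r pl ql rl; have /= := iso _ _ _ (map_f _ pl) (map_f _ ql) (map_f _ rl).
- by move=> p q pl ql; have /= := eqs _ _ (map_f _ pl) (map_f _ ql).
- by move=> _ _ _ /mapP[p pl ->] /mapP[q ql ->] /mapP[r rl ->]; rewrite /= iso.
- by move=> _ _ /mapP[p pl ->] /mapP[q ql ->]; rewrite /= eqs.
Qed.

(** * Embeddings and endomorphisms of the circular order *)

Definition scirc_mono (e : rat -> rat) :=
  forall x y z, scirc x y z -> scirc (e x) (e y) (e z).

(** Two distinct points belong to a strictly ordered triple, whose image has distinct entries; so
    [e] is injective, and by totality it reflects the order. *)
Lemma scirc_mono_iso e (s : seq rat) : scirc_mono e -> scirc_iso [seq (x, e x) | x <- s].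
Proof.
move=> eP; have e_inj : injective e.
  move=> x y exy; apply/eqP/negPn/negP => xy.
  have [z xyz] : exists z, scirc x y z.
    have [xy'|yx'] := orP (lt_total xy).
      by exists (y + 1)%R; rewrite /scirc; lra.
    by exists ((x + y) / 2)%R; rewrite /scirc; lra.
  by have [] := scirc_neq (eP _ _ _ xyz); rewrite exy eqxx.
split=> [_ _ _ /mapP[x _ ->] /mapP[y _ ->] /mapP[z _ ->] /=|].
  apply/idP/idP; first exact: eP.
  move=> exyz; have [exy eyz ezx] := scirc_neq exyz.
  rewrite !(inj_eq e_inj) in exy eyz ezx.
  have /orP[//|/eP/scirc_asym] := scirc_total exy eyz ezx.
  by rewrite exyz.
by move=> _ _ /mapP[x _ ->] /mapP[y _ ->] /=; rewrite (inj_eq e_inj).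
Qed.

(** By [circE] the reflexive order is the complement of the reversed strict one, so preserving the
    former amounts to reflecting the latter. *)
Lemma End_circP (f : Tr rat) :
  reflect (forall x y z, scirc (f z) (f y) (f x) -> scirc z y x) (f \in End_circ).
Proof.
apply: (iffP (asboolP _)) => fP x y z.
  by rewrite 2!scircE; apply: contra => /fP.
by rewrite !circE; apply: contra => /fP.
Qed.

(** The graph of [e] over [s] is a finite partial isomorphism, which back-and-forth extends to an
    automorphism. *)
Lemma circ_homogeneous e (s : seq rat) : scirc_mono e -> exists (h k : trmonoid End_circ),
  inverses h k /\ {in s, e =1 trval h}.
Proof.
move=> eP.
have [|l y liso|l [] //|h [k [hK kK h0 hP]]] :=
  back_and_forth (scirc_mono_iso s eP).
- exact: scirc_iso_forth.
- have [x xP] := scirc_iso_forth y ((scirc_iso_swap l).2 liso).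
  by exists x; apply/scirc_iso_swap.
have hC x y z : scirc (h x) (h y) (h z) = scirc x y z.
  have [l [iso _] lP] := hP [:: x; y; z].
  by rewrite -(iso _ _ _ (lP x _) (lP y _) (lP z _)) // !inE eqxx ?orbT.
have hM : (h : Tr rat) \in End_circ by apply/End_circP => x y z; rewrite hC.
have kM : (k : Tr rat) \in End_circ by apply/End_circP => x y z; rewrite -hC !kK.
exists (Trmonoid hM), (Trmonoid kM); split.
  by split; apply: trmonoidP => x; [exact: kK | exact: hK].
by move=> x xs; have /= -> := h0 (x, e x) (map_f _ xs).
Qed.

Lemma End_circ_mono (e : trmonoid End_circ) : scirc_mono (trval e) -> in_units_closure e.
Proof. by move=> eP s; exact: circ_homogeneous. Qed.

Lemma scirc_mono_End (e : Tr rat) : scirc_mono e -> e \in End_circ.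
Proof.
move=> eP; apply/End_circP => x y z xyz.
have [zy yx xz] := scirc_neq xyz.
have /orP[//|/eP/scirc_asym] : scirc z y x || scirc x y z.
  by apply: scirc_total; [move: zy|move: yx|move: xz]; apply: contra => /eqP->.
by rewrite xyz.
Qed.

(** Of the two open arcs between points [x] and [y] of one fiber, at least one lies within the
    fiber; otherwise [p] and [z] could be chosen outside it, one on each arc. *)
Definition convex_fibers (f : rat -> rat) := forall x p y z,
  scirc x p y -> scirc x y z -> f x = f y -> f p = f x \/ f z = f x.

Lemma scirc_trans a b c d : scirc a b c -> scirc a c d -> scirc a b d /\ scirc b c d.
Proof. by rewrite /scirc => abc acd; split; move: abc acd; lra. Qed.

(** As [q] lies on one of the four arcs between the cyclically ordered [x], [p], [y], [z], three
    consecutive ones among them appear in order when read from [q]. *)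
Lemma scirc4 x p y z q : scirc x p y -> scirc x y z ->
  q != x -> q != p -> q != y -> q != z ->
  [|| scirc q p y && scirc q y z, scirc q y z && scirc q z x,
      scirc q z x && scirc q x p | scirc q x p && scirc q p y].
Proof.
move=> xpy xyz qx qp qy qz.
have [xp _ _] := scirc_neq xpy; have [xy _ zx] := scirc_neq xyz.
have [xqy|xyq] : scirc x q y \/ scirc x y q.
  have := scirc_total xy _ qx; rewrite eq_sym => /(_ qy).
  by rewrite -[scirc q y x]scirc_rot => /orP[]; auto.
  have [xqz qyz] := scirc_trans xqy xyz.
  have [xqp|xpq] : scirc x q p \/ scirc x p q.
    have := scirc_total xp _ qx; rewrite eq_sym => /(_ qp).
    by rewrite -[scirc q p x]scirc_rot => /orP[]; auto.
    by have [_ ->] := scirc_trans xqp xpy; rewrite qyz.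
  by rewrite qyz -(scirc_rot x) xqz orbT.
have [xpq pyq] := scirc_trans xpy xyq.
have qxp : scirc q x p by rewrite scirc_rot.
have [xqz|xzq] : scirc x q z \/ scirc x z q.
  have := scirc_total _ _ qx; move=> /(_ z); rewrite eq_sym zx eq_sym qz => /(_ isT isT).
  by rewrite -[scirc q z x]scirc_rot => /orP[]; auto.
  by rewrite -(scirc_rot x) xqz qxp !orbT.
by rewrite qxp (scirc_rot q p) pyq !orbT.
Qed.

Lemma three_values_convex (f : trmonoid End_circ) (x0 x1 x2 : rat) :
  trval f x0 != trval f x1 -> trval f x1 != trval f x2 -> trval f x2 != trval f x0 ->
  convex_fibers (trval f).
Proof.
set g := trval f => n01 n12 n20 x p y z xpy xyz gxy.
have gP a b c : scirc (g c) (g b) (g a) -> scirc c b a.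
  by have /End_circP := valP f; apply.
have circP a b c : scirc a b c -> ~~ scirc (g c) (g b) (g a).
  by move=> abc; apply/negP => /gP/scirc_asym; rewrite abc.
apply: contrapT => /not_orP[/eqP px /eqP zx].
(* If [p] and [z] have different values, the triples [p, y, z] and [z, x, p] impose opposite
   orientations on the same three values. *)
have [gpz|gpz] := eqVneq (g p) (g z); last first.
  have pyz : scirc p y z by move: xpy xyz; rewrite /scirc; lra.
  have zxp : scirc z x p by move: xpy xyz; rewrite /scirc; lra.
  have := circP _ _ _ pyz; have := circP _ _ _ zxp; rewrite -gxy.
  have := @scirc_total (g p) (g x) (g z) px; rewrite eq_sym zx eq_sym gpz.
  by move=> /(_ isT isT) /orP[->//|->].
(* Now two values alternate along [x], [p], [y], [z]. Read from a point [q] with a third value, they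
   alternate on three points, which again imposes both orientations. *)
have [q qx qp] : exists2 q, g q != g x & g q != g p.
  apply: contrapT => nq.
  have two t : (g t == g x) || (g t == g p).
    apply/negPn/negP; rewrite negb_or => /andP[? ?].
    by apply: nq; exists t.
  move: n01 n12 n20.
  case/orP: (two x0) => /eqP->; case/orP: (two x1) => /eqP->;
    by case/orP: (two x2) => /eqP->; rewrite ?eqxx.
have gneq t : g q != g t -> q != t by apply: contra => /eqP->.
have alt a b c : scirc q a b -> scirc q b c -> g a = g c -> g a != g b ->
    g q != g a -> g q != g b -> False.
  move=> qab qbc gac ab qa qb.
  have := circP _ _ _ qab; have := circP _ _ _ qbc; rewrite -gac.
  have := @scirc_total (g q) (g a) (g b) qa ab; rewrite eq_sym qb => /(_ isT).
  by rewrite scirc_rot => /orP[]->.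
have qy : g q != g y by rewrite -gxy.
have qz : g q != g z by rewrite -gpz.
have xp : g x != g p by rewrite eq_sym.
have := scirc4 xpy xyz (gneq _ qx) (gneq _ qp) (gneq _ qy) (gneq _ qz).
case/or4P=> /andP[A B]; apply: alt A B _ _ _ _ => //; rewrite -?gxy -?gpz //.
Qed.

(** * Factorizations through a common endomorphism *)

Lemma two_valued_End (f : Tr rat) a b : (forall x, f x = a \/ f x = b) -> f \in End_circ.
Proof.
move=> fab; apply/End_circP => x y z /scirc_neq[].
by case: (fab x) => ->; case: (fab y) => ->; case: (fab z) => ->; rewrite ?eqxx.
Qed.

Lemma End_circ_closed : closed [set f : Tr rat | f \in End_circ].
Proof.
move=> f clf; apply/asboolP => x y z xyz.
have [|g [/asboolP gM fg]] := clf [set g : Tr rat | {in [:: x; y; z], forall t, g t = f t}].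
  by apply/Tr_nbhsP; exists [:: x; y; z].
by have := gM _ _ _ xyz; rewrite !fg // !inE eqxx ?orbT.
Qed.

Lemma increasing_scirc_mono e : {homo e : x y / (x < y)%R} -> scirc_mono e.
Proof.
by move=> eP x y z; rewrite /scirc => /or3P[]/andP[/eP A /eP B]; rewrite A B ?orbT.
Qed.

Lemma End_scirc_distinct (f : trmonoid End_circ) x y z :
  trval f x != trval f y -> trval f y != trval f z -> trval f z != trval f x ->
  scirc x y z -> scirc (trval f x) (trval f y) (trval f z).
Proof.
move=> xy yz zx xyz; have /End_circP fP := valP f.
have /orP[//|/fP/scirc_asym] := scirc_total xy yz zx.
by rewrite xyz.
Qed.

Section Lexicographic.
Variable psi : rat * rat -> rat.
Hypothesis psi_lt : forall a b c d,
  (psi (a, b) < psi (c, d))%R = (a < c)%R || (a == c) && (b < d)%R.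

Lemma two_valued_embedding (f : rat -> rat) (b : rat) :
  scirc_mono (fun x => psi (x, (f x == b)%:R)%R).
Proof. by apply: increasing_scirc_mono => x y xy; rewrite psi_lt xy. Qed.

(** The point [p v] lies outside the fiber over [v], so the cut there orders the fiber linearly
    without tearing it apart. *)
Lemma convex_embedding (f : trmonoid End_circ) (p : rat -> rat) :
  convex_fibers (trval f) -> (forall v, trval f (p v) != v) ->
  scirc_mono (fun x => psi (trval f x, cut_at (p (trval f x)) x)).
Proof.
set g := trval f => conv gp; set e := fun x => _.
have e_lt x y : (g x < g y)%R -> (e x < e y)%R by move=> xy; rewrite psi_lt xy.
have e_fib x y : g x = g y -> (e x < e y)%R = (cut_at (p (g x)) x < cut_at (p (g x)) y)%R.
  by move=> xy; rewrite psi_lt xy ltxx eqxx.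
have p_neq x : x != p (g x) by apply/eqP => xp; move: (gp (g x)); rewrite -xp eqxx.
(* If [x] did not precede [y] after the cut, [p (g x)] and [z] would lie on different arcs between
   [x] and [y], both outside the fiber. *)
have pair x y z : scirc x y z -> g x = g y -> g z != g x -> scirc (e x) (e y) (e z).
  move=> xyz xy zx; have exy : (e x < e y)%R.
    have yp : y != p (g x) by rewrite xy.
    rewrite e_fib // cut_lt // scirc_rot.
    have [nxy _ _] := scirc_neq xyz.
    have := @scirc_total x y (p (g x)) nxy yp; rewrite eq_sym => /(_ (p_neq x)).
    case/orP=> //; rewrite -scirc_rot => xpy.
    case: (conv _ _ _ _ xpy xyz xy) => [E|/eqP]; last by rewrite (negPf zx).
    by have := gp (g x); rewrite E eqxx.
  rewrite /scirc exy; have [zx'|xz'] := orP (lt_total zx).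
    by rewrite (e_lt z x) ?orbT.
  by rewrite (e_lt y z) // -xy.
move=> x y z xyz.
have [xy|xy] := eqVneq (g x) (g y); have [yz|yz] := eqVneq (g y) (g z).
- have yp : y != p (g x) by rewrite xy.
  have zp : z != p (g x) by rewrite xy yz.
  rewrite -(cut_scirc (p_neq x) yp zp) in xyz.
  by rewrite /scirc !e_fib -?yz -?xy.
- by apply: pair; rewrite // xy eq_sym.
- by rewrite scirc_rot; apply: pair; rewrite // -?yz // -scirc_rot.
- have [zx|zx] := eqVneq (g z) (g x).
    by rewrite -scirc_rot; apply: pair; rewrite // ?zx 1?eq_sym // scirc_rot.
  have := End_scirc_distinct xy yz zx xyz.
  by rewrite /scirc => /or3P[]/andP[/e_lt A /e_lt B]; rewrite A B ?orbT.
Qed.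

End Lexicographic.

(** * Continuity of the isomorphism and of its inverse *)

Section Continuity.
Variables (Omega : countType) (N : umagmaClosed (Tr Omega)).
Variable theta : trmonoid End_circ -> trmonoid N.
Hypotheses (clN : closed [set f : Tr Omega | f \in N]).
Hypotheses (theta_hom : monoid.monoid_morphism theta)
  (theta_bij : bijective theta).

Let thetaM f g : theta (f * g)%g = (theta f * theta g)%g.
Proof. exact: theta_hom.2. Qed.

Let const_End (a : rat) : ((fun=> a) : Tr rat) \in End_circ.
Proof. by apply: (@two_valued_End _ a a); left. Qed.

Let const (a : rat) : trmonoid End_circ := Trmonoid (const_End a).

(* The constant maps embed the action on Q in the action on Omega. *)
Lemma inverse_continuous (x : rat) : exists t : seq Omega, forall f g,
  {in t, trval (theta f) =1 trval (theta g)} -> trval f x = trval g x.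
Proof.
have [w w01] : exists w, trval (theta (const 0%R)) w <> trval (theta (const 1%R)) w.
  apply: contrapT => nw; suff : const 0%R = const 1%R.
    by move=> /(congr1 (fun f => trval f 0%R)).
  apply: (bij_inj theta_bij); apply: trmonoidP => w.
  by apply: contrapT => ww; apply: nw; exists w.
have inj a b : trval (theta (const a)) w = trval (theta (const b)) w -> a = b.
  move=> ab; apply: contrapT => /eqP nab; apply: w01.
  (* This map sends [b] to 1 and [a] to 0, so it carries a coincidence at [w] for the constants [a]
     and [b] over to 0 and 1. *)
  have gM : ((fun x => if x == b then 1%R else 0%R) : Tr rat) \in End_circ.
    by apply: (@two_valued_End _ 1%R 0%R) => y /=; case: ifP; auto.
  have E c : (Trmonoid gM * const c)%g = const (if c == b then 1%R else 0%R).
    exact: trmonoidP.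
  have := E a; have := E b; rewrite (negPf nab) eqxx => <- <-; rewrite !thetaM.
  by rewrite -[LHS]/(trval (theta (Trmonoid gM)) (trval (theta (const a)) w)) ab.
exists [:: trval (theta (const x)) w] => f g fg; apply: inj.
have E h : const (trval h x) = (h * const x)%g by apply: trmonoidP.
rewrite !E !thetaM -[LHS]/(trval (theta f) (trval (theta (const x)) w)).
by rewrite fg // mem_head.
Qed.

Section Neighborhood.
Variables (s : seq rat) (t : seq Omega).
Hypothesis st : forall e e',
  in_units_closure e -> in_units_closure e' -> {in s, trval e =1 trval e'} ->
  {in t, trval (theta e) =1 trval (theta e')}.

Let common_factor (r f f' : trmonoid End_circ) (e e' : rat -> rat) :
  scirc_mono e -> scirc_mono e' -> {in s, e =1 e'} ->
  (forall x, trval r (e x) = trval f x) -> (forall x, trval r (e' x) = trval f' x) ->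
  {in t, trval (theta f) =1 trval (theta f')}.
Proof.
move=> eP e'P ee' re re' y yt.
have -> : f = (r * Trmonoid (scirc_mono_End eP : (e : Tr rat) \in End_circ))%g.
  by apply: trmonoidP => x; rewrite -re.
have -> : f' = (r * Trmonoid (scirc_mono_End e'P : (e' : Tr rat) \in End_circ))%g.
  by apply: trmonoidP => x; rewrite -re'.
rewrite !thetaM -[LHS]/(trval (theta r) (trval (theta (Trmonoid _)) y)).
rewrite (@st (Trmonoid (scirc_mono_End eP)) (Trmonoid (scirc_mono_End e'P))) //.
  exact: (@End_circ_mono (Trmonoid _) eP).
exact: (@End_circ_mono (Trmonoid _) e'P).
Qed.

Lemma two_valued_agree (f f' : trmonoid End_circ) (a b : rat) :
  (forall x, trval f x = a \/ trval f x = b) ->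
  (forall x, trval f' x = a \/ trval f' x = b) ->
  {in s, trval f =1 trval f'} -> {in t, trval (theta f) =1 trval (theta f')}.
Proof.
move=> fab f'ab ff'.
have [psi [[phi psiK phiK] psi_lt]] := rat_lexi_iso.
have rM : ((fun q => if (phi q).2 == 1%R then b else a) : Tr rat) \in End_circ.
  by apply: (@two_valued_End _ b a) => q /=; case: ifP; auto.
have rE (g : trmonoid End_circ) : (forall x, trval g x = a \/ trval g x = b) -> forall x,
    trval (Trmonoid rM) (psi (x, (trval g x == b)%:R)%R) = trval g x.
  move=> gab x; rewrite /= psiK /=.
  case: (gab x) => ->; rewrite ?eqxx //; by have [->|//] := eqVneq a b; case: (_ == _).
apply: (common_factor (r := Trmonoid rM)
  (two_valued_embedding psi_lt (trval f) b)
  (two_valued_embedding psi_lt (trval f') b)) => [x xs||].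
- by rewrite ff'.
- exact: rE.
- exact: rE.
Qed.

Lemma convex_agree (f f' : trmonoid End_circ) (x0 x1 : rat) :
  convex_fibers (trval f) -> convex_fibers (trval f') ->
  trval f x0 = trval f' x0 -> trval f x1 = trval f' x1 -> trval f x0 != trval f x1 ->
  {in s, trval f =1 trval f'} -> {in t, trval (theta f) =1 trval (theta f')}.
Proof.
move=> conv conv' f0 f1 f01 ff'.
have [psi [[phi psiK phiK] psi_lt]] := rat_lexi_iso.
have r_lt q q' : ((phi q).1 < (phi q').1)%R -> (q < q')%R.
  rewrite -[in X in _ -> X](phiK q) -[in X in _ -> X](phiK q').
  by case: (phi q) (phi q') => a b [c d] /=; rewrite psi_lt => ->.
have rM : ((fun q => (phi q).1) : Tr rat) \in End_circ.
  apply/End_circP => x y z; rewrite /scirc.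
  by move=> /or3P[]/andP[/r_lt A /r_lt B]; rewrite A B ?orbT.
(* One choice of cut points serves both maps, so that the embeddings agree wherever [f] and [f'] do.
   The common values at [x0] and [x1] differ, hence one of these points is outside both fibers over
   [v]. *)
pose p v := if v == trval f x0 then x1 else x0.
have fp v : trval f (p v) != v.
  by rewrite /p; have [->|] := eqVneq v; rewrite eq_sym.
have f'p v : trval f' (p v) != v.
  by rewrite /p; have [->|] := eqVneq v; rewrite -?f0 -?f1 eq_sym.
apply: (common_factor (r := Trmonoid rM) (convex_embedding psi_lt conv fp)
  (convex_embedding psi_lt conv' f'p)) => [x xs|x|x].
- by rewrite ff'.
- by rewrite /= psiK.
- by rewrite /= psiK.
Qed.

End Neighborhood.

(** The fiber over [b] is a fiber of [f] and the one over [a] is its complement; the complement of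
    an arc is again an arc. *)
Lemma fiber_indicator_convex (f : rat -> rat) (a b : rat) :
  a != b -> convex_fibers f -> convex_fibers (fun x => if f x == b then b else a).
Proof.
move=> ab conv x p y z xpy xyz /=.
move/eqP: ab => nab; have nba := nesym nab.
have [xb|xb] := eqVneq (f x) b; have [yb|yb] := eqVneq (f y) b => // _.
  have := conv _ _ _ _ xpy xyz; rewrite xb yb => /(_ erefl)[]->; rewrite eqxx; auto.
have [pb|pb] := eqVneq (f p) b; have [zb|zb] := eqVneq (f z) b; auto.
(* Here [p] and [z] share the fiber of [f] over [b], while [x] and [y] lie outside it, one on each
   arc between them. *)
have pyz : scirc p y z by move: xpy xyz; rewrite /scirc; lra.
have pzx : scirc p z x by move: xpy xyz; rewrite /scirc; lra.
have := conv _ _ _ _ pyz pzx; rewrite pb zb => /(_ erefl)[]E.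
  by rewrite E eqxx in yb.
by rewrite E eqxx in xb.
Qed.

Lemma three_values_or_two (f : rat -> rat) :
  (exists x0 x1 x2, [/\ f x0 != f x1, f x1 != f x2 & f x2 != f x0]) \/
  (exists x0 x1, forall x, f x = f x0 \/ f x = f x1).
Proof.
have [[x1 f1]|nf1] := pselect (exists x1, f x1 != f 0%R); last first.
  right; exists 0%R, 0%R => x; left; apply/eqP/negPn/negP => fx.
  by apply: nf1; exists x.
have [[x2 [f2 f2']]|nf2] := pselect (exists x2, f x2 != f 0%R /\ f x2 != f x1).
  by left; exists 0%R, x1, x2; rewrite ![_ == f x2]eq_sym [_ == f x1]eq_sym.
right; exists 0%R, x1 => x; apply: contrapT => /not_orP[/eqP ? /eqP ?].
by apply: nf2; exists x.
Qed.

Lemma two_valued_convex_agree (s : seq rat) (t : seq Omega) (f f' : trmonoid End_circ)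
    (x0 x1 : rat) :
  (forall e e', in_units_closure e -> in_units_closure e' ->
    {in s, trval e =1 trval e'} -> {in t, trval (theta e) =1 trval (theta e')}) ->
  let a := trval f' x0 in let b := trval f' x1 in
  a != b -> (forall x, trval f x = a \/ trval f x = b) -> convex_fibers (trval f') ->
  {in s, trval f =1 trval f'} -> {in t, trval (theta f) =1 trval (theta f')}.
Proof.
move=> st a b ab fab conv ff' y yt.
have gM : ((fun x => if trval f' x == b then b else a) : Tr rat) \in End_circ.
  by apply: (@two_valued_End _ b a) => x /=; case: ifP; auto.
have gE : {in s, trval f =1 trval (Trmonoid gM)}.
  move=> x xs; rewrite /= -ff' //.
  by case: (fab x) => ->; rewrite ?eqxx ?(negPf ab).
rewrite (@two_valued_agree s t st f (Trmonoid gM) a b) //; last first.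
  by move=> x /=; case: ifP; auto.
apply: (@convex_agree s t st (Trmonoid gM) f' x0 x1) => //=.
- exact: fiber_indicator_convex.
- by rewrite -/a (negPf ab).
- by rewrite eqxx.
- by rewrite -/a -/b eqxx (negPf ab).
- by move=> x xs; rewrite -[RHS]ff' // gE.
Qed.

Lemma theta_continuous (f : trmonoid End_circ) (w : Omega) : exists s : seq rat, forall f',
  {in s, trval f' =1 trval f} -> trval (theta f') w = trval (theta f) w.
Proof.
have [s st] := units_closure_continuous End_circ_closed clN theta_hom theta_bij
  inverse_continuous [:: w].
have wt := mem_head w [::].
have [[x0 [x1 [x2 [f01 f12 f20]]]]|[x0 [x1 fx]]] := three_values_or_two (trval f).
  (* Prescribing three distinct values forces [f'] to have convex fibers as well. *)
  exists ([:: x0; x1; x2] ++ s) => f' ff'.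
  have f'E x : x \in [:: x0; x1; x2] ++ s -> trval f x = trval f' x by move=> /ff' ->.
  have [E0 E1 E2] : [/\ trval f x0 = trval f' x0, trval f x1 = trval f' x1 &
      trval f x2 = trval f' x2] by split; apply: f'E; rewrite !inE eqxx ?orbT.
  apply/esym/(@convex_agree s [:: w] st f f' x0 x1) => //.
  - exact: three_values_convex f01 f12 f20.
  - by apply: (@three_values_convex f' x0 x1 x2); rewrite -?E0 -?E1 -?E2.
  - by move=> x xs; apply: f'E; rewrite mem_cat xs orbT.
exists ([:: x0; x1] ++ s) => f' ff'.
have ff's : {in s, trval f =1 trval f'} by move=> x xs; rewrite ff' // mem_cat xs orbT.
have [E0 E1] : trval f' x0 = trval f x0 /\ trval f' x1 = trval f x1.
  by split; apply: ff'; rewrite !inE eqxx ?orbT.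
(* If [f] is constant and [f'] is not, the second value is taken from [f']; if [f'] is constant, it
   equals [f]. *)
have [[x1' [f01 f'x]]|const_f'] : (exists x1', trval f' x0 != trval f' x1' /\
    forall x, trval f x = trval f' x0 \/ trval f x = trval f' x1') \/
    (forall x, trval f' x = trval f' x0).
  have [E|nE] := eqVneq (trval f x0) (trval f x1); last first.
    by left; exists x1; rewrite E0 E1.
  have [[z fz]|nz] := pselect (exists z, trval f' x0 != trval f' z).
    left; exists z; split=> // x; left; rewrite E0.
    by case: (fx x); rewrite -?E.
  right=> x; apply/esym/eqP/negPn/negP => fz.
  by apply: nz; exists x.
- have [[y0 [y1 [y2 [n01 n12 n20]]]]|[y0 [y1 f'y]]] := three_values_or_two (trval f').
    apply/esym/(@two_valued_convex_agree s [:: w] f f' x0 x1') => //.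
    exact: three_values_convex n01 n12 n20.
  apply/esym/(@two_valued_agree s [:: w] st f f' (trval f' x0) (trval f' x1')) => //.
  move: f01; case: (f'y x0) => ->; case: (f'y x1') => ->; rewrite ?eqxx //; move=> _ x;
    by case: (f'y x); auto.
- suff -> : f' = f by [].
  apply: trmonoidP => x; rewrite const_f'.
  by case: (fx x) => ->; rewrite -?E0 -?E1 // const_f'.
Qed.

End Continuity.

(** * Passage to the induced topology *)

Lemma trmonoid_nbhs (X : countType) (M : umagmaClosed (Tr X)) (f : trmonoid M) (s : seq X) :
  nbhs f [set g : trmonoid M | {in s, trval g =1 trval f}].
Proof.
have : nbhs (trval f) [set g : Tr X | {in s, forall x, g x = trval f x}].
  by apply/Tr_nbhsP; exists s.
exact: (@initial_continuous _ _ (@trval X M) f).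
Qed.

Lemma trmonoid_continuous (X Y : countType) (M : umagmaClosed (Tr X))
    (N : umagmaClosed (Tr Y)) (h : trmonoid M -> trmonoid N) :
  (forall f y, exists s : seq X, forall g, {in s, trval g =1 trval f} ->
    trval (h g) y = trval (h f) y) -> continuous h.
Proof.
move=> hP; apply: continuous_comp_initial => f U /Tr_nbhsP[t tU].
have [s sP] := choice (hP f).
apply: filterS (trmonoid_nbhs f (flatten (map s t))) => g gf.
apply: tU => y yt; apply: sP => x xs; apply: gf.
by apply/flattenP; exists (s y) => //; exact: map_f.
Qed.

Theorem theorem3p10 : automatic_homeomorphicity End_circ.
Proof.
move=> Omega N theta clN theta_hom theta_bij; split.
  apply: trmonoid_continuous => f y; exact: theta_continuous.
have [theta' thetaK theta'K] := theta_bij.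
exists theta'; split=> //; apply: trmonoid_continuous => f x.
have [t tx] := inverse_continuous theta_hom theta_bij x.
by exists t => g gf; apply: tx; rewrite !theta'K.
Qed.
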